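(* Consider the DC/AC converter $$C_{dc}\dot v_{dc}=-G_{dc}v_{dc}+i_{dc}-\tfrac12 m_{\alpha\beta}^\top i_{\alpha\beta},\qquad C\,\dot v_{\alpha\beta}=-i_{load}+i_{\alpha\beta},\qquad L\,\dot i_{\alpha\beta}=-R\,i_{\alpha\beta}+\tfrac12 m_{\alpha\beta}v_{dc}-v_{\alpha\beta}$$ with the controller $\dot\theta_v=\eta v_{dc}$, $m_{\alpha\beta}=\mu\begin{bmatrix}-\sin\theta_v\\ \cos\theta_v\end{bmatrix}$. Around a steady-state operating point $(\hat v_x,\omega_x)$ of the switching voltage $v_x=\tfrac12m_{\alpha\beta}v_{dc}$, the active power droop coefficients are $$d_{\hat v_x}=-\frac{8G_{dc}}{\mu^2}\hat v_x+\frac{2i_{dc}}{\mu},\qquad d_{\omega_x}=-\frac{2G_{dc}}{\eta^2}\omega_x+\frac{i_{dc}}{\eta}.$$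
   Context: $v_{dc}(t)\in\mathbb R$, $v_{\alpha\beta}(t),i_{\alpha\beta}(t),i_{load}(t)\in\mathbb R^2$; $C_{dc},G_{dc},C,L,R,\eta,i_{dc}>0$ and $\mu\in(0,1]$ are constant. Steady state with frequency $\omega_s\ne0$ means $\dot v_{dc}=0$ and $\dot z=\omega_s\begin{bmatrix}0&-1\\1&0\end{bmatrix}z$ for every AC signal $z(t)\in\mathbb R^2$. $\hat v_x>0$ and $\omega_x$ denote the amplitude and frequency of $v_x=\hat v_x(-\sin\theta_x,\cos\theta_x)^\top$, $\omega_x=\dot\theta_x$, and $P_x=v_x^\top i_{\alpha\beta}$ is the active power flowing out of the node $v_x$. In steady state $P_x$ is a function of $\hat v_x$ alone, and likewise a function of $\omega_x$ alone; the droop coefficients are the local linear sensitivities $d_{\hat v_x}=\partial P_x/\partial\hat v_x$ and $d_{\omega_x}=\partial P_x/\partial\omega_x$ of these functions at the operating point.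
   Formalization: The DC voltage v_dc is assumed positive in all steady states considered; for v_dc<0 the amplitude is −μv_dc/2, P_x is no longer one function of the amplitude, and the stated amplitude droop formula fails (2i_dc/μ changes sign). *)

(* Defs.v *)
From HB Require Import structures.
From mathcomp Require Import all_boot all_order all_algebra.
From mathcomp Require Import all_classical all_reals all_analysis.

Set Implicit Arguments.
Unset Strict Implicit.
Unset Printing Implicit Defensive.

Import Order.TTheory GRing.Theory Num.Theory.
Import numFieldNormedType.Exports.
Local Open Scope ring_scope.
Local Open Scope classical_set_scope.

Section plane.
Variable R : realType.

Definition vec2 (a b : R) : 'cV[R]_2 := \col_i (if i == 0 then a else b).

(* the matrix [0 -1; 1 0] *)
Definition J2 : 'M[R]_2 :=
  \matrix_(i, j) (if i == j then 0 else if i == 0 then -1 else 1).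

Definition dot2 (z w : 'cV[R]_2) : R := (z^T *m w) 0 0.

Definition phasor (theta : R) : 'cV[R]_2 := vec2 (- sin theta) (cos theta).

(* [derivable] is required explicitly because [derive1] is a total operator. *)
Definition rotates (w : R) (z : R -> 'cV[R]_2) : Prop :=
  forall t : R, derivable z t 1 /\ derive1 z t = w *: (J2 *m z t).

End plane.

Record converter (R : realType) := Converter {
  Cdc : R;
  Gdc : R;
  Cf : R;
  Lf : R;
  Rf : R;
  eta_gain : R;
  idc : R;
  mu_amp : R
}.

Record well_posed (R : realType) (p : converter R) : Prop := WellPosed {
  Cdc_gt0 : 0 < Cdc p;
  Gdc_gt0 : 0 < Gdc p;
  Cf_gt0 : 0 < Cf p;
  Lf_gt0 : 0 < Lf p;
  Rf_gt0 : 0 < Rf p;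
  eta_gain_gt0 : 0 < eta_gain p;
  idc_gt0 : 0 < idc p;
  mu_amp_gt0 : 0 < mu_amp p;
  mu_amp_le1 : mu_amp p <= 1
}.

(* The load current [iload] is an exogenous signal, not tied to a load model. *)
Record signals (R : realType) := Signals {
  vdc : R -> R;
  vab : R -> 'cV[R]_2;
  iab : R -> 'cV[R]_2;
  iload : R -> 'cV[R]_2;
  thetav : R -> R
}.

Section model.
Variables (R : realType) (p : converter R) (s : signals R).

Definition mab (t : R) : 'cV[R]_2 := mu_amp p *: phasor (thetav s t).

Definition vx (t : R) : 'cV[R]_2 := 2^-1 *: (vdc s t *: mab t).

Definition Px (t : R) : R := dot2 (vx t) (iab s t).

Record closed_loop : Prop := ClosedLoop {
  vdc_derivable : forall t : R, derivable (vdc s) t 1;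
  vab_derivable : forall t : R, derivable (vab s) t 1;
  iab_derivable : forall t : R, derivable (iab s) t 1;
  thetav_derivable : forall t : R, derivable (thetav s) t 1;
  vdc_dynamics : forall t : R,
    Cdc p * derive1 (vdc s) t =
      - (Gdc p * vdc s t) + idc p - 2^-1 * dot2 (mab t) (iab s t);
  vab_dynamics : forall t : R,
    Cf p *: derive1 (vab s) t = - iload s t + iab s t;
  iab_dynamics : forall t : R,
    Lf p *: derive1 (iab s) t =
      - (Rf p *: iab s t) + 2^-1 *: (vdc s t *: mab t) - vab s t;
  thetav_dynamics : forall t : R, derive1 (thetav s) t = eta_gain p * vdc s t
}.

Record steady_state (ws : R) : Prop := SteadyState {
  ws_neq0 : ws != 0;
  vdc_steady : forall t : R, derive1 (vdc s) t = 0;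
  vab_steady : rotates ws (vab s);
  iab_steady : rotates ws (iab s);
  iload_steady : rotates ws (iload s);
  mab_steady : rotates ws mab;
  vx_steady : rotates ws vx
}.

Definition polar_form (z : R -> 'cV[R]_2) (zhat w : R) : Prop :=
  0 < zhat /\
  exists theta : R -> R,
    forall t : R, [/\ z t = zhat *: phasor (theta t),
      derivable theta t 1 & derive1 theta t = w].

End model.

(* [q] is a value of the active power in some closed-loop steady state whose
   switching voltage has amplitude [vhat] and frequency [w].
   The condition [0 < vdc] fixes the branch of the polar decomposition: it says
   that [vx] is in phase with the modulation signal, i.e. that
   [vhat = mu_amp * vdc / 2] rather than [vhat = - mu_amp * vdc / 2]; with both
   branches present the power would not be a function of [vhat]. *)
Definition operating_point (R : realType) (p : converter R) (vhat w q : R)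
    : Prop :=
  exists (s : signals R) (ws : R),
    [/\ closed_loop p s, steady_state p s ws, (forall t : R, 0 < vdc s t),
        polar_form (vx p s) vhat w & exists t : R, q = Px p s t].

(* [S x q] reads: [q] is attained in a steady state where the quantity of
   interest equals [x]. [q] must be a function [f] of [x] alone; as [x0] is
   interior to the set of attained [x], the germ of [f] at [x0], hence [d], is
   determined by [S]. *)
Definition sensitivity (R : realType) (S : R -> R -> Prop) (x0 d : R) : Prop :=
  exists f : R -> R,
    [/\ forall x q : R, S x q -> q = f x,
        \forall x \near x0, exists q : R, S x q,
        derivable f x0 1 & derive1 f x0 = d].

Definition amplitude_droop (R : realType) (p : converter R) (vhat d : R) : Prop :=
  sensitivity (fun v q => exists w : R, operating_point p v w q) vhat d.

Definition frequency_droop (R : realType) (p : converter R) (w d : R) : Prop :=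
  sensitivity (fun w' q => exists v : R, operating_point p v w' q) w d.

(* Main.v *)
Require Import Defs.
From HB Require Import structures.
From mathcomp Require Import all_boot all_order all_algebra.
From mathcomp Require Import all_classical all_reals all_analysis.
From mathcomp Require Import ring lra.

Set Implicit Arguments.
Unset Strict Implicit.
Unset Printing Implicit Defensive.

Import Order.TTheory GRing.Theory Num.Theory.
Import numFieldNormedType.Exports.
Local Open Scope ring_scope.

(** Everything reduces to one number, the constant DC voltage [c] of the steady
state.  The modulation signal [mab] has constant amplitude and turns at the rate
[eta_gain * vdc] imposed by the controller, while steady state makes it turn at
[ws]; the switching voltage [vx] is a scaled copy of [mab] turning at the same
rate.  Hence [wx = eta_gain * c], and comparing lengths [vhatx = mu_amp * c / 2].
The DC equation with a vanishing derivative says that the power sent through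
the switches is what the DC source delivers minus the loss in [Gdc], that is
[Px = c * (idc - Gdc * c)] ([operating_point_dc]).

Conversely every [c > 0] occurs ([dc_operating_point]).  Taking the current in
phase with the modulation, its amplitude is dictated by the DC balance; the
inductor equation then dictates the capacitor voltage, and the capacitor
equation dictates the load current, which is free.  All AC signals so obtained are
combinations of a rotating unit vector and its quarter turn, so they rotate too.

Thus amplitude and frequency are both of the form [x = k * c] with [k > 0], every
[x > 0] is attained, and the power is the quadratic [x / k * (idc - Gdc * x / k)]
of [x].  Its derivative is computed once, in [dc_power_sensitivity], and
specialised to [k = mu_amp / 2] and [k = eta_gain]. *)

(** * Rotating vectors in the plane *)

Section rotation.
Variable R : realType.
Implicit Types (z : R -> 'cV[R]_2) (th : R -> R) (u v : 'cV[R]_2).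

Lemma J2K v : J2 R *m (J2 R *m v) = - v.
Proof.
apply/matrixP => i j; rewrite ord1 !mxE !big_ord_recl !big_ord0 !mxE /=.
rewrite !big_ord_recl !big_ord0 !mxE /=.
case: i => [[|[|//]] ?] /=.
- rewrite (_ : Ordinal _ = ord0); last exact: val_inj.
  by ring.
- rewrite (_ : Ordinal _ = lift ord0 ord0); last exact: val_inj.
  by ring.
Qed.

Lemma dot2Zl a u v : dot2 (a *: u) v = a * dot2 u v.
Proof. by rewrite /dot2 linearZ /= -scalemxAl mxE. Qed.

Lemma dot2Zr a u v : dot2 u (a *: v) = a * dot2 u v.
Proof. by rewrite /dot2 -scalemxAr mxE. Qed.

Lemma dot2_phasor x : dot2 (phasor x) (phasor x) = 1 :> R.
Proof.
rewrite /dot2 !mxE !big_ord_recl big_ord0 !mxE /=.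
by rewrite -(cos2Dsin2 x); ring.
Qed.

Lemma is_derive_col2 z t (dz : 'cV[R]_2) :
  (forall i, is_derive t (1 : R) (fun x => z x i 0) (dz i 0)) ->
  is_derive t (1 : R) z dz.
Proof.
move=> dzi; have dz1 : derivable z t 1.
  by apply/derivable_mxP => i j; rewrite ord1; have [] := dzi i.
split=> //; rewrite derive_mx//; apply/matrixP => i j.
by rewrite mxE ord1; have [_ ->] := dzi i.
Qed.

(** The quarter turn [J2] sends a unit vector to the tangent of the unit circle
there, so the chain rule yields the angular speed times [J2]. *)
Lemma is_derive_phasor th t w : is_derive t (1 : R) th w ->
  is_derive t (1 : R) (fun x => phasor (th x)) (w *: (J2 R *m phasor (th t))).
Proof.
move=> dth.
have dsin : is_derive t (1 : R) (sin \o th) (cos (th t) * w).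
  exact: is_derive1_comp.
have dcos : is_derive t (1 : R) (cos \o th) (- sin (th t) * w).
  exact: is_derive1_comp.
apply: is_derive_col2 => -[[|[|//]] i2].
- rewrite (_ : (fun x => _) = - (sin \o th)); last by apply/funext => x; rewrite !mxE.
  by apply: is_derive_eq; rewrite !mxE !big_ord_recl big_ord0 !mxE /=; ring.
- rewrite (_ : (fun x => _) = cos \o th); last by apply/funext => x; rewrite !mxE.
  by apply: is_derive_eq; rewrite !mxE !big_ord_recl big_ord0 !mxE /=; ring.
Qed.

(** Restated with [is_derive], the hypothesis of steady rotation composes with
the differentiation rules. *)
Lemma rotatesP w z :
  rotates w z <-> forall t, is_derive t (1 : R) z (w *: (J2 R *m z t)).
Proof.
split=> dz t; have [dz1 dz2] := dz t.
- by split; rewrite -?derive1E.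
- by rewrite derive1E.
Qed.

Lemma rotatesZ w a z : rotates w z -> rotates w (fun t => a *: z t).
Proof.
move=> /rotatesP rz; apply/rotatesP => t; have := rz t => dz.
rewrite -scalemxAr scalerA mulrC -scalerA; exact: is_deriveZ.
Qed.

Lemma rotatesD w z1 z2 : rotates w z1 -> rotates w z2 ->
  rotates w (fun t => z1 t + z2 t).
Proof.
move=> /rotatesP r1 /rotatesP r2; apply/rotatesP => t.
have := r1 t; have := r2 t => d2 d1.
rewrite mulmxDr scalerDr; exact: is_deriveD.
Qed.

Lemma rotates_phasor w : rotates w (fun t : R => phasor (w * t)).
Proof.
apply/rotatesP => t; apply: is_derive_phasor.
change (is_derive t (1 : R) (w \*: id) w).
by apply: is_derive_eq; rewrite /GRing.scale/= mulr1.
Qed.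

Lemma rotates_quadrature w : rotates w (fun t : R => J2 R *m phasor (w * t)).
Proof.
rewrite (_ : (fun t => _) = (fun t : R => phasor (w * t + pi / 2))).
  apply/rotatesP => t; apply: is_derive_phasor.
  change (is_derive t (1 : R) (w \*: id + cst (pi / 2)) w).
  by apply: is_derive_eq; rewrite /GRing.scale/= mulr1 addr0.
(* the quarter turn of a phasor is the phasor a quarter period later *)
apply/funext => t; apply/matrixP => i j; rewrite ord1.
rewrite !mxE !big_ord_recl big_ord0 !mxE sinDpihalf cosDpihalf.
by case: i => [[|[|//]] ?] /=; ring.
Qed.

(** A polar angle of a rotating vector of constant nonzero length has no choice of
speed: both the angle's derivative and [ws] multiply the same nonzero tangent
vector.  This identifies the frequency of [vx] with that of [mab]. *)
Lemma rotates_polar_frequency ws a th z : a != 0 ->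
  (forall t, derivable th t 1) -> (forall t, z t = a *: phasor (th t)) ->
  rotates ws z -> forall t, derive1 th t = ws.
Proof.
move=> a0 dth zE /rotatesP rz t.
have /derivableP/is_derive_phasor/(is_deriveZ a) dz := dth t.
have [_ dzE] := rz t; have [_ dzE'] := dz.
have : a *: ('D_1 th t *: (J2 R *m phasor (th t))) = ws *: (J2 R *m (z t)).
  by rewrite -dzE' -dzE; congr ('D_1 _ t); apply/funext => x; rewrite zE.
(* a second quarter turn brings the tangent vector back to the phasor, whose
   product with itself is 1 *)
rewrite zE -scalemxAr [in RHS]scalerA [ws * _]mulrC -[in RHS]scalerA => /(scalerI a0)/(congr1 (mulmx (J2 R))).
rewrite -!scalemxAr J2K !scalerN => /oppr_inj/(congr1 (@dot2 R ^~ (phasor (th t)))).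
by rewrite !dot2Zl dot2_phasor !mulr1 derive1E.
Qed.

(** Polar amplitudes are unique once they are positive; with free signs,
[(a, x)] and [(- a, x + pi)] give the same vector. *)
Lemma phasor_amplitude (a b x y : R) : 0 < a -> 0 < b ->
  a *: phasor x = b *: phasor y -> a = b.
Proof.
move=> a0 b0 e.
have : dot2 (a *: phasor x) (a *: phasor x) = dot2 (b *: phasor y) (b *: phasor y).
  by rewrite e.
rewrite !dot2Zl !dot2Zr !dot2_phasor !mulr1 -!expr2 => /eqP.
by rewrite eqrXn2 ?ltW// => /eqP.
Qed.

End rotation.

(** * Steady states of the converter *)

Section converter_power.
Variables (R : realType) (p : converter R).
Hypothesis hp : well_posed p.

Lemma vx_phasor (s : signals R) t :
  vx p s t = (mu_amp p * vdc s t / 2) *: phasor (thetav s t).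
Proof. by rewrite /vx /mab !scalerA; congr (_ *: _); ring. Qed.

(** The power [Px] is [vdc] times the current [(mab . iab) / 2] that the AC side draws
in the DC equation, so an equilibrium of the DC capacitor determines it. *)
Lemma Px_dc_balance (s : signals R) t : closed_loop p s ->
  derive1 (vdc s) t = 0 -> Px p s t = vdc s t * (idc p - Gdc p * vdc s t).
Proof.
move=> cl v0.
have -> : Px p s t = 2^-1 * (vdc s t * dot2 (mab p s t) (iab s t)).
  by rewrite /Px /vx dot2Zl dot2Zl.
have := vdc_dynamics cl t; rewrite v0 mulr0 => e.
have -> : idc p - Gdc p * vdc s t = 2^-1 * dot2 (mab p s t) (iab s t) by lra.
by ring.
Qed.

(** The DC voltage parametrises all operating points: amplitude, frequency and
power are read off from it.  This is what makes the power a function of either the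
amplitude or the frequency alone. *)
Lemma operating_point_dc v w q : operating_point p v w q ->
  exists2 c, 0 < c &
    [/\ v = mu_amp p * c / 2, w = eta_gain p * c & q = c * (idc p - Gdc p * c)].
Proof.
move=> [s [ws [cl ss vdc0 [v0 [th thP]] [t ->]]]].
have mu0 := mu_amp_gt0 hp.
exists (vdc s t) => //; split.
- have [e _ _] := thP t; move: e; rewrite vx_phasor => /esym/phasor_amplitude.
  by apply=> //; rewrite divr_gt0 ?mulr_gt0.
- have [_ _ <-] := thP t; rewrite -(thetav_dynamics cl t).
  (* [vx] and [mab] share the steady-state rate [ws] *)
  transitivity ws.
    apply: (@rotates_polar_frequency _ ws v th (vx p s)).
    + by rewrite gt_eqF.
    + by move=> x; have [] := thP x.
    + by move=> x; have [] := thP x.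
    + exact: vx_steady ss.
  apply/esym; apply: (@rotates_polar_frequency _ ws (mu_amp p) _ (mab p s)) => //.
  + by rewrite gt_eqF.
  + exact: thetav_derivable cl.
  + exact: mab_steady ss.
- by apply: Px_dc_balance => //; exact: vdc_steady ss t.
Qed.

(** Construction of a steady state with prescribed DC voltage [c].  The current is
taken along the direct axis [e], and the DC balance fixes its amplitude [a]; the
inductor equation then yields the components [vd] and [vq] of the capacitor voltage
along [e] and along the quadrature axis [je]. *)
Section witness.
Variable c : R.
Let w := eta_gain p * c.
Let e (t : R) : 'cV[R]_2 := phasor (w * t).
Let je (t : R) : 'cV[R]_2 := J2 R *m e t.
Let a := 2 * (idc p - Gdc p * c) / mu_amp p.
Let vd := mu_amp p * c / 2 - Rf p * a.
Let vq := - (Lf p * w * a).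

(** The load current is whatever the capacitor equation leaves over,
[iab - Cf * vab'], expanded with [e' = w *: je] and [je' = - w *: e]. *)
Definition steady_signals : signals R := {|
  vdc := cst c;
  vab := fun t => vd *: e t + vq *: je t;
  iab := fun t => a *: e t;
  iload := fun t => (a + Cf p * w * vq) *: e t + (- (Cf p * w * vd)) *: je t;
  thetav := fun t => w * t |}.

Let rotates_e : rotates w e. Proof. exact: rotates_phasor. Qed.
Let rotates_je : rotates w je. Proof. exact: rotates_quadrature. Qed.

Lemma rotates_combination b d : rotates w (fun t => b *: e t + d *: je t).
Proof. by apply: rotatesD; exact: rotatesZ. Qed.

Lemma steady_signals_closed_loop : closed_loop p steady_signals.
Proof.
have mu0 := mu_amp_gt0 hp.
have dth t : is_derive t (1 : R) (fun x => w * x) w.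
  change (is_derive t (1 : R) (w \*: id) w).
  by apply: is_derive_eq; rewrite /GRing.scale/= mulr1.
have ri : rotates w (fun t => a *: e t) by exact: rotatesZ.
split=> t /=.
- exact: derivable_cst.
- by have [] := rotates_combination vd vq t.
- by have [] := ri t.
- by have [] := dth t.
- rewrite derive1_cst /mab /= dot2Zl dot2Zr dot2_phasor /a.
  by field; rewrite gt_eqF.
- have [_ ->] := rotates_combination vd vq t.
  rewrite mulmxDr -!scalemxAr /je J2K.
  by apply/matrixP => i j; rewrite !mxE; ring.
- have [_ ->] := ri t; rewrite -scalemxAr /mab /= -/(e t) -/(je t).
  by apply/matrixP => i j; rewrite !mxE /vd /vq; field.
- by rewrite derive1E; have [_ ->] := dth t.
Qed.

Lemma dc_operating_point : 0 < c ->
  operating_point p (mu_amp p * c / 2) w (c * (idc p - Gdc p * c)).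
Proof.
move=> c0; have mu0 := mu_amp_gt0 hp; have eta0 := eta_gain_gt0 hp.
have cl := steady_signals_closed_loop.
exists steady_signals, w; split => //.
- split => /=.
  + by rewrite gt_eqF ?mulr_gt0.
  + by move=> t; exact: derive1_cst.
  + exact: rotates_combination.
  + exact: rotatesZ.
  + exact: rotates_combination.
  + exact: rotatesZ.
  + have -> : vx p steady_signals = (fun t => (mu_amp p * c / 2) *: e t).
      by apply/funext => t; rewrite vx_phasor.
    exact: rotatesZ.
- split; first by rewrite divr_gt0 ?mulr_gt0.
  exists (thetav steady_signals) => t; split.
  + exact: vx_phasor.
  + exact: thetav_derivable cl t.
  + exact: thetav_dynamics cl t.
- exists 0; rewrite Px_dc_balance//=.
  exact: derive1_cst.
Qed.

End witness.

(** Common core of the two droop formulas.  A quantity proportional to the DC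
voltage recovers [c = x / k], so the power is a quadratic in [x]; since all
positive [x] are attained, its derivative at [x0] is the sensitivity. *)
Lemma dc_power_sensitivity (S : R -> R -> Prop) k x0 : 0 < k ->
  (forall x q, S x q <->
     exists2 c, 0 < c & x = k * c /\ q = c * (idc p - Gdc p * c)) ->
  0 < x0 ->
  sensitivity S x0 (- (2 * Gdc p / k ^+ 2) * x0 + idc p / k).
Proof.
move=> k0 SP x00.
pose f (x : R) : R := x / k * (idc p - Gdc p * (x / k)).
have fE : f = (idc p / k) \*: id - (Gdc p / k ^+ 2) \*: (id ^+ 2).
  rewrite exprfctE; apply/funext => x; rewrite /f.
  change (x / k * (idc p - Gdc p * (x / k)) =
          idc p / k * x - Gdc p / k ^+ 2 * x ^+ 2).
  by field; rewrite gt_eqF.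
have df : is_derive x0 (1 : R) f (- (2 * Gdc p / k ^+ 2) * x0 + idc p / k).
  rewrite fE; apply: is_derive_eq.
  by rewrite /GRing.scale/=; field; rewrite gt_eqF.
exists f; split.
- move=> x q /SP[c c0 [-> ->]]; by rewrite /f [k * c]mulrC mulfK ?gt_eqF.
- near=> x; have x_gt0 : 0 < x by near: x; exact: lt_nbhsr.
  exists (x / k * (idc p - Gdc p * (x / k))); apply/SP; exists (x / k).
    exact: divr_gt0.
  by split=> //; field; rewrite gt_eqF.
- by have [] := df.
- by rewrite derive1E; have [_ ->] := df.
Unshelve. all: by end_near. Qed.

End converter_power.

Theorem corollary5p2p4 (R : realType) (p : converter R) (hp : well_posed p)
    (vhatx wx Px0 : R) (hop : operating_point p vhatx wx Px0) :
  amplitude_droop p vhatx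
    (- (8 * Gdc p / mu_amp p ^+ 2) * vhatx + 2 * idc p / mu_amp p) /\
  frequency_droop p wx
    (- (2 * Gdc p / eta_gain p ^+ 2) * wx + idc p / eta_gain p).
Proof.
have mu0 := mu_amp_gt0 hp; have eta0 := eta_gain_gt0 hp.
have [c c0 [vE wE _]] := operating_point_dc hp hop.
split.
(* the amplitude is [mu_amp / 2] times the DC voltage *)
- rewrite (_ : _ + _ = - (2 * Gdc p / (mu_amp p / 2) ^+ 2) * vhatx
                       + idc p / (mu_amp p / 2)); last first.
    by field; rewrite gt_eqF.
  apply: dc_power_sensitivity; first by rewrite divr_gt0.
    move=> v q; split=> [[w /(operating_point_dc hp)[d d0 [-> _ ->]]]|].
      by exists d => //; split=> //; ring.
    move=> [d d0 [-> ->]]; exists (eta_gain p * d).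
    by rewrite mulrAC; exact: dc_operating_point.
  by rewrite vE divr_gt0 ?mulr_gt0.
- apply: dc_power_sensitivity => //; last by rewrite wE mulr_gt0.
  move=> w q; split=> [[v /(operating_point_dc hp)[d d0 [_ -> ->]]]|].
    by exists d.
  move=> [d d0 [-> ->]]; exists (mu_amp p * d / 2).
  exact: dc_operating_point.
Qed.
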